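(* Let $G=\mathrm{SL}(3,\mathbb{C})$, let $R=\mathbb{C}[t_{(\pm1)},t_{(\pm2)},t_{(\pm3)},t_{(\pm4)}]$ be a polynomial ring in eight variables, and let $\Pi:R[t_{(5)},t_{(-5)}]\to\mathbb{C}[G\times G]^G$ be the trace homomorphism defined in the context. There exists a polynomial $Q\in R$ such that $Q-t_{(5)}t_{(-5)}\in\ker(\Pi)$, and in particular \begin{align*} Q=&\,9-6t_{(1)}t_{(-1)} -6t_{(2)}t_{(-2)} -6t_{(3)}t_{(-3)} -6t_{(4)}t_{(-4)}+t_{(1)}^3 +t_{(2)}^3 +t_{(3)}^3\\ &+t_{(4)}^3 +t_{(-1)}^3 + t_{(-2)}^3 +t_{(-3)}^3 +t_{(-4)}^3 -3t_{(-4)}t_{(-3)}t_{(-1)} -3t_{(4)}t_{(3)}t_{(1)}\\ &-3t_{(-4)}t_{(2)}t_{(3)} -3t_{(4)}t_{(-2)}t_{(-3)}+3t_{(-4)}t_{(-2)}t_{(1)} +3t_{(4)}t_{(2)}t_{(-1)}\\ &+ 3t_{(1)}t_{(2)}t_{(-3)} +3t_{(-1)}t_{(-2)}t_{(3)}+t_{(-2)}t_{(-1)}t_{(2)}t_{(1)}+t_{(-3)}t_{(-2)}t_{(3)}t_{(2)}\\ &+t_{(-4)}t_{(-1)}t_{(4)}t_{(1)} +t_{(-4)}t_{(-2)}t_{(4)}t_{(2)} +t_{(-3)}t_{(-1)}t_{(3)}t_{(1)}+t_{(-3)}t_{(-4)}t_{(3)}t_{(4)}\\ &+t_{(-4)}^2t_{(-3)}t_{(-2)}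 +t_{(4)}^2t_{(3)}t_{(2)} +t_{(-1)}^2t_{(-2)}t_{(-4)} +t_{(1)}^2t_{(2)}t_{(4)}+t_{(1)}t_{(-2)}^2t_{(-3)}\\ &+t_{(-1)}t_{(2)}^2t_{(3)} +t_{(-4)}t_{(-3)}t_{(1)}^2 +t_{(4)}t_{(3)}t_{(-1)}^2 +t_{(-4)}t_{(2)}t_{(-3)}^2 +t_{(4)}t_{(-2)}t_{(3)}^2 \\ &+t_{(-1)}^2t_{(-3)}t_{(2)} +t_{(1)}^2t_{(3)}t_{(-2)} +t_{(-4)}t_{(1)}t_{(2)}^2 +t_{(4)}t_{(-1)}t_{(-2)}^2+t_{(-4)}t_{(3)}t_{(-2)}^2\\ &+t_{(4)}t_{(-3)}t_{(2)}^2 +t_{(1)}t_{(3)}t_{(-4)}^2 +t_{(-1)}t_{(-3)}t_{(4)}^2 +t_{(-1)}t_{(-4)}t_{(3)}^2\\ &+t_{(1)}t_{(4)}t_{(-3)}^2-2t_{(-3)}^2t_{(-2)}t_{(-1)}-2t_{(3)}^2t_{(2)}t_{(1)} -2t_{(-4)}^2t_{(-1)}t_{(2)}\\ &-2t_{(4)}^2t_{(1)}t_{(-2)}+t_{(-1)}^2t_{(-2)}^2t_{(-3)}+t_{(1)}^2t_{(2)}^2t_{(3)}+t_{(-4)}t_{(-1)}^2t_{(2)}^2\\ &+t_{(4)}t_{(1)}^2t_{(-2)}^2-t_{(-4)}t_{(-2)}^2t_{(2)}t_{(1)} -t_{(4)}t_{(2)}^2t_{(-2)}t_{(-1)}\\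 &-t_{(-3)}t_{(1)}^2t_{(-1)}t_{(2)}-t_{(3)}t_{(-1)}^2t_{(1)}t_{(-2)}-t_{(-3)}t_{(2)}^2t_{(-2)}t_{(1)} -t_{(3)}t_{(-2)}^2t_{(2)}t_{(-1)}\\ &-t_{(-4)}t_{(-2)}t_{(-1)}t_{(1)}^2 -t_{(4)}t_{(2)}t_{(1)}t_{(-1)}^2-t_{(-1)}t_{(-2)}^3t_{(1)}-t_{(-1)}t_{(2)}^3t_{(1)} \\ &-t_{(-1)}^3t_{(-2)}t_{(2)}-t_{(1)}^3t_{(-2)}t_{(2)}-t_{(-4)}t_{(-3)}t_{(-2)}t_{(-1)}t_{(2)}-t_{(4)}t_{(3)}t_{(2)}t_{(1)}t_{(-2)}\\ &-t_{(-1)}t_{(1)}t_{(2)}t_{(-4)}t_{(3)} -t_{(-1)}t_{(1)}t_{(-2)}t_{(4)}t_{(-3)}+ t_{(-2)}t_{(-1)}^2t_{(1)}^2t_{(2)} +t_{(-1)}t_{(-2)}^2t_{(2)}^2t_{(1)}. \end{align*}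
   Context: $G=\mathrm{SL}(3,\mathbb{C})$ acts on $G\times G$ by simultaneous conjugation; $\mathbf{x}_1,\mathbf{x}_2$ are the generic unimodular $3\times3$ matrices of the two factors. $\Pi$ is the $\mathbb{C}$-algebra homomorphism with $t_{(1)}\mapsto\mathrm{tr}(\mathbf{x}_1)$, $t_{(-1)}\mapsto\mathrm{tr}(\mathbf{x}_1^{-1})$, $t_{(2)}\mapsto\mathrm{tr}(\mathbf{x}_2)$, $t_{(-2)}\mapsto\mathrm{tr}(\mathbf{x}_2^{-1})$, $t_{(3)}\mapsto\mathrm{tr}(\mathbf{x}_1\mathbf{x}_2)$, $t_{(-3)}\mapsto\mathrm{tr}(\mathbf{x}_1^{-1}\mathbf{x}_2^{-1})$, $t_{(4)}\mapsto\mathrm{tr}(\mathbf{x}_1\mathbf{x}_2^{-1})$, $t_{(-4)}\mapsto\mathrm{tr}(\mathbf{x}_1^{-1}\mathbf{x}_2)$, $t_{(5)}\mapsto\mathrm{tr}(\mathbf{x}_1\mathbf{x}_2\mathbf{x}_1^{-1}\mathbf{x}_2^{-1})$, $t_{(-5)}\mapsto\mathrm{tr}(\mathbf{x}_2\mathbf{x}_1\mathbf{x}_2^{-1}\mathbf{x}_1^{-1})$. *)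

(* Defs.v *)
From HB Require Import structures.
From mathcomp Require Import all_boot all_order all_algebra.
From mathcomp Require Import boolp classical_sets functions reals.
From mathcomp Require Export complex.
From mathcomp Require Export mpoly.

Set Implicit Arguments.
Unset Strict Implicit.
Unset Printing Implicit Defensive.

Import Order.TTheory GRing.Theory Num.Theory.

Local Open Scope ring_scope.

(* [K : realType] is the field of real numbers and [K[i]] that of complex
   numbers. *)

Record SL3 (K : realType) := MkSL3 {
  SL3_mx :> 'M[K[i]]_3;
  _ : \det SL3_mx == 1 }.

HB.instance Definition _ (K : realType) := [isSub for @SL3_mx K].
HB.instance Definition _ (K : realType) := [Choice of SL3 K by <:].

Section SL3Group.
Variable K : realType.
Implicit Types g h : SL3 K.

Lemma det_SL3 g : \det g = 1.
Proof. by case: g => A /= /eqP. Qed.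

Lemma SL3_unitmx g : (g : 'M_3) \in unitmx.
Proof. by rewrite unitmxE det_SL3 unitr1. Qed.

Fact SL3_one_subproof : \det (1%:M : 'M[K[i]]_3) == 1.
Proof. by rewrite det1. Qed.

Fact SL3_mul_subproof g h : \det (SL3_mx g *m SL3_mx h) == 1.
Proof. by rewrite det_mulmx !det_SL3 mulr1. Qed.

Fact SL3_inv_subproof g : \det (invmx (SL3_mx g)) == 1.
Proof. by rewrite det_inv det_SL3 invr1. Qed.

Definition SL3_one := MkSL3 SL3_one_subproof.
Definition SL3_mul g h := MkSL3 (SL3_mul_subproof g h).
Definition SL3_inv g := MkSL3 (SL3_inv_subproof g).

Fact SL3_mulA : associative SL3_mul.
Proof. by move=> g h k; apply: val_inj; rewrite /= mulmxA. Qed.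

Fact SL3_mul1g : left_id SL3_one SL3_mul.
Proof. by move=> g; apply: val_inj; rewrite /= mul1mx. Qed.

Fact SL3_mulg1 : right_id SL3_one SL3_mul.
Proof. by move=> g; apply: val_inj; rewrite /= mulmx1. Qed.

Fact SL3_mulVg : left_inverse SL3_one SL3_inv SL3_mul.
Proof. by move=> g; apply: val_inj; rewrite /= mulVmx ?SL3_unitmx. Qed.

Fact SL3_mulgV : right_inverse SL3_one SL3_inv SL3_mul.
Proof. by move=> g; apply: val_inj; rewrite /= mulmxV ?SL3_unitmx. Qed.

HB.instance Definition _ := isGroup.Build (SL3 K)
  SL3_mulA SL3_mul1g SL3_mulg1 SL3_mulVg SL3_mulgV.
HB.instance Definition _ := isPointed.Build (SL3 K) SL3_one.

End SL3Group.

Definition conj_pair (K : realType) (g : SL3 K) (z : SL3 K * SL3 K) :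
    SL3 K * SL3 K :=
  (g * z.1 * g^-1, g * z.2 * g^-1)%g.

Definition pair_fun (K : realType) := (SL3 K * SL3 K)%type -> K[i].

Section PairFun.
Variable K : realType.

HB.instance Definition _ :=
  GRing.ComNzRing.copy (pair_fun K) ((SL3 K * SL3 K)%type -> K[i]).

Definition pair_fun_scale (c : K[i]) (f : pair_fun K) : pair_fun K :=
  fun z => c * f z.

Fact pair_fun_scaleA a b f :
  pair_fun_scale a (pair_fun_scale b f) = pair_fun_scale (a * b) f.
Proof. by apply/funext => z; exact: mulrA. Qed.
Fact pair_fun_scale1 : left_id 1 pair_fun_scale.
Proof. by move=> f; apply/funext => z; exact: mul1r. Qed.
Fact pair_fun_scaleDr : right_distributive pair_fun_scale +%R.
Proof. by move=> a f g; apply/funext => z; exact: mulrDr. Qed.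
Fact pair_fun_scaleDl f : {morph pair_fun_scale^~ f : a b / a + b}.
Proof. by move=> a b; apply/funext => z; exact: mulrDl. Qed.

HB.instance Definition _ := GRing.Zmodule_isLmodule.Build K[i] (pair_fun K)
  pair_fun_scaleA pair_fun_scale1 pair_fun_scaleDr pair_fun_scaleDl.

Fact pair_fun_scaleAl (a : K[i]) (f g : pair_fun K) :
  a *: (f * g) = a *: f * g.
Proof. by apply/funext => z; exact: mulrA. Qed.

HB.instance Definition _ :=
  GRing.Lmodule_isLalgebra.Build K[i] (pair_fun K) pair_fun_scaleAl.
HB.instance Definition _ :=
  GRing.Lalgebra_isComAlgebra.Build K[i] (pair_fun K).

End PairFun.

Definition pair_entries (K : realType) (z : SL3 K * SL3 K)
    (i : 'I_(3 * 3 + 3 * 3)) : K[i] :=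
  row_mx (mxvec z.1) (mxvec z.2) 0 i.

Definition regular_fun (K : realType) : {pred pair_fun K} := fun f =>
  `[< exists p : {mpoly K[i][3 * 3 + 3 * 3]},
        forall z, f z = p.@[pair_entries z] >].

Fact regular_fun_subalg (K : realType) : subalg_closed (@regular_fun K).
Proof.
split.
- by apply/asboolP; exists 1 => z; rewrite meval1.
- move=> a f g /asboolP[p fp] /asboolP[q gq]; apply/asboolP.
  by exists (a *: p + q) => z; rewrite mevalD mevalZ -fp -gq.
- move=> f g /asboolP[p fp] /asboolP[q gq]; apply/asboolP.
  by exists (p * q) => z; rewrite mevalM -fp -gq.
Qed.

HB.instance Definition _ (K : realType) := GRing.isSubalgClosed.Build
  K[i] (pair_fun K) (@regular_fun K) (@regular_fun_subalg K).

(* The coordinate ring C[G * G] of the affine variety G * G, as its ring of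
   regular (i.e. polynomial) functions. *)
Record coord_ring (K : realType) := CoordRing {
  coord_fun : pair_fun K;
  _ : coord_fun \in @regular_fun K }.

HB.instance Definition _ (K : realType) := [isSub for @coord_fun K].
HB.instance Definition _ (K : realType) := [Choice of coord_ring K by <:].
HB.instance Definition _ (K : realType) :=
  [SubChoice_isSubAlgebra of coord_ring K by <:].
HB.instance Definition _ (K : realType) :=
  [SubNzRing_isSubComNzRing of coord_ring K by <:].

(* Classical inverses in C[G * G], which let [x^-1] denote the inverse of a
   matrix over C[G * G]. *)
Section CoordRingUnits.
Variable K : realType.
Implicit Types f g : coord_ring K.

Definition coord_unit : {pred coord_ring K} := fun f =>
  `[< exists g, g * f = 1 >].

Definition coord_inv f : coord_ring K :=
  if pselect (exists g, g * f = 1) is left ex then projT1 (cid ex) else f.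

Fact coord_mulVx : {in coord_unit, left_inverse 1 coord_inv *%R}.
Proof.
move=> f /asboolP fU; rewrite /coord_inv; case: pselect => // ex.
exact: projT2 (cid ex).
Qed.

Fact coord_unitPl f g : g * f = 1 -> coord_unit f.
Proof. by move=> gf; apply/asboolP; exists g. Qed.

Fact coord_inv_out : {in [predC coord_unit], coord_inv =1 id}.
Proof.
move=> f; rewrite inE => /asboolPn fU.
by rewrite /coord_inv; case: pselect.
Qed.

HB.instance Definition _ := GRing.ComNzRing_hasMulInverse.Build (coord_ring K)
  coord_mulVx coord_unitPl coord_inv_out.

End CoordRingUnits.

Definition invariant_fun (K : realType) : {pred coord_ring K} := fun f =>
  `[< forall g z, coord_fun f (conj_pair g z) = coord_fun f z >].

Fact invariant_fun_subalg (K : realType) : subalg_closed (@invariant_fun K).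
Proof.
split.
- by apply/asboolP.
- move=> a f g /asboolP fI /asboolP gI; apply/asboolP => h z.
  by rewrite /= -[LHS]/(a * coord_fun f _ + coord_fun g _) fI gI.
- move=> f g /asboolP fI /asboolP gI; apply/asboolP => h z.
  by rewrite /= -[LHS]/(coord_fun f _ * coord_fun g _) fI gI.
Qed.

HB.instance Definition _ (K : realType) := GRing.isSubalgClosed.Build
  K[i] (coord_ring K) (@invariant_fun K) (@invariant_fun_subalg K).

Record inv_ring (K : realType) := InvRing {
  inv_fun :> coord_ring K;
  _ : inv_fun \in @invariant_fun K }.

HB.instance Definition _ (K : realType) := [isSub for @inv_fun K].
HB.instance Definition _ (K : realType) := [Choice of inv_ring K by <:].
HB.instance Definition _ (K : realType) :=
  [SubChoice_isSubAlgebra of inv_ring K by <:].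
HB.instance Definition _ (K : realType) :=
  [SubNzRing_isSubComNzRing of inv_ring K by <:].

Section Generic.
Variable K : realType.

Fact entry1_subproof (i j : 'I_3) :
  (fun z => SL3_mx z.1 i j) \in @regular_fun K.
Proof.
apply/asboolP; exists 'X_(lshift _ (mxvec_index i j)) => z.
by rewrite mevalXU /pair_entries row_mxEl mxvecE.
Qed.

Fact entry2_subproof (i j : 'I_3) :
  (fun z => SL3_mx z.2 i j) \in @regular_fun K.
Proof.
apply/asboolP; exists 'X_(rshift _ (mxvec_index i j)) => z.
by rewrite mevalXU /pair_entries row_mxEr mxvecE.
Qed.

(* The generic unimodular matrices: their entries are the coordinate functions
   on the two factors. *)
Definition gen1 : 'M[coord_ring K]_3 :=
  \matrix_(i, j) CoordRing (entry1_subproof i j).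
Definition gen2 : 'M[coord_ring K]_3 :=
  \matrix_(i, j) CoordRing (entry2_subproof i j).

End Generic.

(* The words [word x y k] are the arguments of the traces that are the images
   of the variables t_(k), k = +-1, ..., +-5; other values of k are junk. *)
Definition word (A : comUnitRingType) (x y : 'M[A]_3) (k : int) : 'M[A]_3 :=
  match k with
  | 1%Z => x            | (-1)%Z => x^-1
  | 2%Z => y            | (-2)%Z => y^-1
  | 3%Z => x * y        | (-3)%Z => x^-1 * y^-1
  | 4%Z => x * y^-1     | (-4)%Z => x^-1 * y
  | 5%Z => x * y * x^-1 * y^-1
  | (-5)%Z => y * x * y^-1 * x^-1
  | _ => 1
  end.

Section WordInvariance.
Variable K : realType.

Definition coord_eval (z : SL3 K * SL3 K) (f : coord_ring K) : K[i] :=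
  coord_fun f z.

Fact coord_eval_zmod z : zmod_morphism (coord_eval z).
Proof. by []. Qed.

Fact coord_eval_monoid z : monoid_morphism (coord_eval z).
Proof. by []. Qed.

HB.instance Definition _ z :=
  GRing.isZmodMorphism.Build (coord_ring K) K[i] (coord_eval z)
    (coord_eval_zmod z).
HB.instance Definition _ z :=
  GRing.isMonoidMorphism.Build (coord_ring K) K[i] (coord_eval z)
    (coord_eval_monoid z).

Lemma coord_evalP (f g : coord_ring K) :
  (forall z, coord_eval z f = coord_eval z g) -> f = g.
Proof. by move=> fg; apply/val_inj/funext. Qed.

Lemma map_gen1 z : map_mx (coord_eval z) (gen1 K) = z.1.
Proof. by apply/matrixP => i j; rewrite !mxE. Qed.

Lemma map_gen2 z : map_mx (coord_eval z) (gen2 K) = z.2.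
Proof. by apply/matrixP => i j; rewrite !mxE. Qed.

Lemma det_gen1 : \det (gen1 K) = 1.
Proof.
by apply: coord_evalP => z; rewrite -det_map_mx map_gen1 det_SL3 rmorph1.
Qed.

Lemma det_gen2 : \det (gen2 K) = 1.
Proof.
by apply: coord_evalP => z; rewrite -det_map_mx map_gen2 det_SL3 rmorph1.
Qed.

Lemma gen1_unit : gen1 K \is a GRing.unit.
Proof. by rewrite -[_ \is a _]/(_ \in unitmx) unitmxE det_gen1 unitr1. Qed.

Lemma gen2_unit : gen2 K \is a GRing.unit.
Proof. by rewrite -[_ \is a _]/(_ \in unitmx) unitmxE det_gen2 unitr1. Qed.

Lemma SL3_unit (g : SL3 K) : SL3_mx g \is a GRing.unit.
Proof. exact: SL3_unitmx. Qed.

Lemma map_word (A B : comUnitRingType) (f : {rmorphism A -> B})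
    (x y : 'M[A]_3) k : x \is a GRing.unit -> y \is a GRing.unit ->
  map_mx f (word x y k) = word (map_mx f x) (map_mx f y) k.
Proof.
move=> xU yU; case: k => [] [|[|[|[|[|[|n]]]]]] //=.
all: by rewrite ?rmorphM /= ?rmorphV ?rmorph1.
Qed.

Lemma conj_word (A : comUnitRingType) (g x y : 'M[A]_3) k :
    g \is a GRing.unit -> x \is a GRing.unit -> y \is a GRing.unit ->
  word (g * x * g^-1) (g * y * g^-1) k = g * word x y k * g^-1.
Proof.
move=> gU xU yU.
have conjV z : z \is a GRing.unit -> (g * z * g^-1)^-1 = g * z^-1 * g^-1.
  move=> zU; have gVU : g^-1 \is a GRing.unit by rewrite unitrV.
  have gzU : g * z \is a GRing.unit by rewrite unitrMl.
  by rewrite !invrM // invrK mulrA.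
have conjM z w : g * z * g^-1 * (g * w * g^-1) = g * (z * w) * g^-1.
  by rewrite !mulrA mulrVK.
case: k => [] [|[|[|[|[|[|n]]]]]] //=.
all: by rewrite ?conjV // ?conjM // mulr1 divrr.
Qed.

Lemma coord_eval_word z k :
  coord_eval z (\tr (word (gen1 K) (gen2 K) k)) =
  \tr (word (SL3_mx z.1) (SL3_mx z.2) k).
Proof.
by rewrite -trace_map_mx map_word ?gen1_unit ?gen2_unit // map_gen1 map_gen2.
Qed.

Fact tr_word_subproof k :
  \tr (word (gen1 K) (gen2 K) k) \in @invariant_fun K.
Proof.
apply/asboolP => g z; rewrite -!/(coord_eval _ _) !coord_eval_word /=.
rewrite -[invmx g]/((SL3_mx g)^-1) !mulmxE conj_word ?SL3_unit //.
by rewrite -mulmxE mxtrace_mulC mulmxA mulVmx ?SL3_unitmx // mul1mx.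
Qed.

End WordInvariance.

Definition tr_word (K : realType) (k : int) : inv_ring K :=
  InvRing (tr_word_subproof K k).

Notation trace_base K := {mpoly K[i][8]}.
Notation trace_poly K := {mpoly (trace_base K)[2]}.

Definition base_labels : seq int := [:: 1; -1; 2; -2; 3; -3; 4; -4].
Definition top_labels : seq int := [:: 5; -5].

(* With R = [trace_base K] and R[t_(5), t_(-5)] = [trace_poly K], [t k] is the
   variable t_(k) of R for k = +-1, ..., +-4, and [u k] is the variable t_(k)
   of R[t_(5), t_(-5)] for k = +-5; both are junk for other k. *)
Definition t {K : realType} (k : int) : trace_base K :=
  'X_(inord (index k base_labels)).
Definition u {K : realType} (k : int) : trace_poly K :=
  'X_(inord (index k top_labels)).
Arguments t {K} k%_Z.
Arguments u {K} k%_Z.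

Section TraceHomomorphism.
Variable K : realType.

Definition Pi_base : trace_base K -> inv_ring K :=
  @mmap 8 K[i] (inv_ring K) (in_alg _) (fun i => tr_word K (nth 0 base_labels i)).
HB.instance Definition _ := GRing.RMorphism.on Pi_base.

Definition Pi : trace_poly K -> inv_ring K :=
  mmap Pi_base (fun i => tr_word K (nth 0 top_labels i)).
HB.instance Definition _ := GRing.RMorphism.on Pi.

Lemma Pi_R (p : trace_base K) : Pi p%:MP = Pi_base p.
Proof. exact: mmapC. Qed.

Lemma Pi_C (c : K[i]) : Pi (c%:MP)%:MP = c%:A.
Proof. by rewrite Pi_R; exact: mmapC. Qed.

Lemma Pi_t (k : int) : k \in base_labels -> Pi (t k)%:MP = tr_word K k.
Proof.
move=> k_base; rewrite Pi_R /Pi_base mmapX mmap1U inordK ?nth_index //.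
by rewrite -[8%N]/(size base_labels) index_mem.
Qed.

Lemma Pi_u (k : int) : k \in top_labels -> Pi (u k) = tr_word K k.
Proof.
move=> k_top; rewrite /Pi mmapX mmap1U inordK ?nth_index //.
by rewrite -[2%N]/(size top_labels) index_mem.
Qed.

End TraceHomomorphism.

(* Main.v *)
(** On unimodular matrices inverses are adjugates, so both sides of the claim are
    polynomials in the 18 matrix entries. Multiplying each term of Q by powers of
    the two determinants makes it homogeneous of degree 6 in the entries of each
    matrix, and the relation then holds identically for all pairs of 3 x 3
    matrices over a commutative ring, which polynomial normalisation decides. *)

Require Import Defs.
From mathcomp Require Import all_boot all_order all_algebra.
From mathcomp Require Import reals.
From mathcomp Require Import ring.

Import GRing.Theory.
Local Open Scope ring_scope.

Section Mx3.
Variable A : comNzRingType.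
Implicit Types (x y : 'M[A]_3) (X Y : nat -> nat -> A).

(** Entries are indexed by [nat] rather than ['I_3], so that at literal indices products, adjugates
    and traces reduce to explicit formulas that [ring] can read. *)
Definition mx3 X : 'M[A]_3 := \matrix_(i, j) X i j.

Lemma mx3_eta x : x = mx3 (fun i j => x (inord i) (inord j)).
Proof. by apply/matrixP => i j; rewrite mxE !inord_val. Qed.

Lemma mxtrace_mx3 X : \tr (mx3 X) = X 0%N 0%N + X 1%N 1%N + X 2%N 2%N.
Proof. by rewrite /mxtrace !big_ord_recl big_ord0 !mxE addr0 addrA. Qed.

Lemma mulmx_mx3 X Y :
  mx3 X * mx3 Y =
    mx3 (fun i j => X i 0 * Y 0 j + X i 1 * Y 1 j + X i 2 * Y 2 j).
Proof.
apply/matrixP => i j.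
by rewrite -mulmxE !mxE !big_ord_recl big_ord0 !mxE addr0 addrA.
Qed.

(* The cofactors have no signs when the indices are taken cyclically. *)
Lemma adj_mx3 X (s := nth 0%N [:: 1; 2; 0]%N) :
  \adj (mx3 X) = mx3 (fun i j => X (s j) (s i) * X (s (s j)) (s (s i))
                             - X (s j) (s (s i)) * X (s (s j)) (s i)).
Proof.
apply/matrixP => i j.
rewrite mxE /cofactor (expand_det_row _ 0) !big_ord_recl big_ord0.
rewrite /cofactor !det_mx11 !mxE.
(* At each of the nine literal positions the signs and the index shifts [bump] evaluate. *)
case: i => [[|[|[|?]]] ?] //; case: j => [[|[|[|?]]] ?] //=.
all: by rewrite /bump /s /=; ring.
Qed.

Lemma det_mx3 X (p := fun i j k => X 0 i * (X 1 j * X 2 k - X 1 k * X 2 j)) :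
  \det (mx3 X) = p 0 1 2 + p 1 2 0 + p 2 0 1.
Proof.
(* As [x * \adj x] is the scalar matrix of [\det x], its corner entry is the determinant, and the
   signless cofactors can be reused. *)
transitivity ((mx3 X * \adj (mx3 X)) 0 0).
  by rewrite -mulmxE mul_mx_adj mxE mulr1n.
by rewrite adj_mx3 mulmx_mx3 mxE /p /=; ring.
Qed.

End Mx3.

(* Here [sk] stands for [t_(-k)], the trace of a word in which inverses have been
   replaced by adjugates, while [e] and [f] stand for the determinants; every
   term has degree 6 in each matrix. *)
Definition commutator_poly (A : comNzRingType)
    (e f t1 s1 t2 s2 t3 s3 t4 s4 : A) : A :=
    9 * e ^+ 2 * f ^+ 2 - 6 * t1 * s1 * e * f ^+ 2 - 6 * t2 * s2 * e ^+ 2 * f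
    - 6 * t3 * s3 * e * f - 6 * t4 * s4 * e * f + t1 ^+ 3 * e * f ^+ 2
    + t2 ^+ 3 * e ^+ 2 * f + t3 ^+ 3 * e * f + t4 ^+ 3 * e + s1 ^+ 3 * f ^+ 2
    + s2 ^+ 3 * e ^+ 2 + s3 ^+ 3 + s4 ^+ 3 * f - 3 * s4 * s3 * s1 * f
    - 3 * t4 * t3 * t1 * e * f - 3 * s4 * t2 * t3 * e * f
    - 3 * t4 * s2 * s3 * e + 3 * s4 * s2 * t1 * e * f
    + 3 * t4 * t2 * s1 * e * f + 3 * t1 * t2 * s3 * e * f
    + 3 * s1 * s2 * t3 * e * f + s2 * s1 * t2 * t1 * e * f
    + s3 * s2 * t3 * t2 * e + s4 * s1 * t4 * t1 * f + s4 * s2 * t4 * t2 * e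
    + s3 * s1 * t3 * t1 * f + s3 * s4 * t3 * t4 + s4 ^+ 2 * s3 * s2
    + t4 ^+ 2 * t3 * t2 * e + s1 ^+ 2 * s2 * s4 * f
    + t1 ^+ 2 * t2 * t4 * e * f + t1 * s2 ^+ 2 * s3 * e
    + s1 * t2 ^+ 2 * t3 * e * f + s4 * s3 * t1 ^+ 2 * f
    + t4 * t3 * s1 ^+ 2 * f + s4 * t2 * s3 ^+ 2 + t4 * s2 * t3 ^+ 2 * e
    + s1 ^+ 2 * s3 * t2 * f + t1 ^+ 2 * t3 * s2 * e * f
    + s4 * t1 * t2 ^+ 2 * e * f + t4 * s1 * s2 ^+ 2 * e
    + s4 * t3 * s2 ^+ 2 * e + t4 * s3 * t2 ^+ 2 * e + t1 * t3 * s4 ^+ 2 * f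
    + s1 * s3 * t4 ^+ 2 + s1 * s4 * t3 ^+ 2 * f + t1 * t4 * s3 ^+ 2
    - 2 * s3 ^+ 2 * s2 * s1 - 2 * t3 ^+ 2 * t2 * t1 * e * f
    - 2 * s4 ^+ 2 * s1 * t2 * f - 2 * t4 ^+ 2 * t1 * s2 * e
    + s1 ^+ 2 * s2 ^+ 2 * s3 + t1 ^+ 2 * t2 ^+ 2 * t3 * e * f
    + s4 * s1 ^+ 2 * t2 ^+ 2 * f + t4 * t1 ^+ 2 * s2 ^+ 2 * e
    - s4 * s2 ^+ 2 * t2 * t1 * e - t4 * t2 ^+ 2 * s2 * s1 * e
    - s3 * t1 ^+ 2 * s1 * t2 * f - t3 * s1 ^+ 2 * t1 * s2 * f
    - s3 * t2 ^+ 2 * s2 * t1 * e - t3 * s2 ^+ 2 * t2 * s1 * e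
    - s4 * s2 * s1 * t1 ^+ 2 * f - t4 * t2 * t1 * s1 ^+ 2 * f
    - s1 * s2 ^+ 3 * t1 * e - s1 * t2 ^+ 3 * t1 * e * f
    - s1 ^+ 3 * s2 * t2 * f - t1 ^+ 3 * s2 * t2 * e * f
    - s4 * s3 * s2 * s1 * t2 - t4 * t3 * t2 * t1 * s2 * e
    - s1 * t1 * t2 * s4 * t3 * f - s1 * t1 * s2 * t4 * s3
    + s2 * s1 ^+ 2 * t1 ^+ 2 * t2 * f + s1 * s2 ^+ 2 * t2 ^+ 2 * t1 * e.

(** The coefficients are integers, which every ring morphism fixes. This carries the polynomial from
    the variables [t k] to the traces of generic words. *)
Lemma rmorph_commutator_poly (A B : comNzRingType) (phi : {rmorphism A -> B})
    (e f t1 s1 t2 s2 t3 s3 t4 s4 : A) :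
  phi (commutator_poly A e f t1 s1 t2 s2 t3 s3 t4 s4) =
  commutator_poly B (phi e) (phi f) (phi t1) (phi s1) (phi t2) (phi s2)
    (phi t3) (phi s3) (phi t4) (phi s4).
Proof.
rewrite /commutator_poly.
ring.
Qed.

(** Adjugates are quadratic in the entries, so each trace on the left has degree 3 in each matrix,
    and the product has the degree 6 of the right side. *)
Lemma tr_commutator_mul_adj (A : comNzRingType) (x y : 'M[A]_3) :
  let x' := \adj x in let y' := \adj y in
  \tr (x * y * x' * y') * \tr (y * x * y' * x') =
  commutator_poly A (\det x) (\det y) (\tr x) (\tr x') (\tr y) (\tr y')
    (\tr (x * y)) (\tr (x' * y')) (\tr (x * y')) (\tr (x' * y)).
Proof.
rewrite /commutator_poly (mx3_eta _ x) (mx3_eta _ y) /=.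
(* The 18 entries become independent atoms for [ring]. *)
move: (fun i j => x _ _) (fun i j => y _ _) => X Y.
rewrite !(det_mx3, adj_mx3, mulmx_mx3, mxtrace_mx3) /=.
ring.
Qed.

Lemma inv_mx_adj (A : comUnitRingType) (n : nat) (x : 'M[A]_n.+1) :
  \det x = 1 -> x^-1 = \adj x.
Proof.
move=> detx.
by rewrite -[LHS]/(invmx x) /invmx unitmxE detx unitr1 invr1 scale1r.
Qed.

(** The entries of the generic matrices are not invariant, so the matrix identity lives over
    [coord_ring K]; since [val] is injective, proving it there suffices. *)
Definition trace_map (K : realType) :
    {rmorphism trace_base K -> coord_ring K} :=
  val \o @Pi_base K.

Lemma trace_map_t (K : realType) (k : int) : k \in base_labels ->
  trace_map K (t k) = \tr (word (gen1 K) (gen2 K) k).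
Proof. by move=> k_base; rewrite /= -Pi_R Pi_t. Qed.

Lemma Pi_sub_commutator (K : realType) (p : trace_base K) :
    trace_map K p = \tr (word (gen1 K) (gen2 K) 5) *
                    \tr (word (gen1 K) (gen2 K) (-5)) ->
  Pi (p%:MP - u 5 * u (-5)) = 0.
Proof.
move=> pE; rewrite rmorphB rmorphM /= Pi_R !Pi_u //; apply/eqP.
by rewrite subr_eq0; apply/eqP/val_inj; rewrite rmorphM; exact: pE.
Qed.

Theorem lemma11 (K : realType) :
  exists2 Q : trace_base K,
    Pi (Q%:MP - u 5 * u (-5)) = 0 &
    Q =
      9 - 6 * t 1 * t (-1) - 6 * t 2 * t (-2) - 6 * t 3 * t (-3)
      - 6 * t 4 * t (-4) + t 1 ^+ 3 + t 2 ^+ 3 + t 3 ^+ 3 + t 4 ^+ 3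
      + t (-1) ^+ 3 + t (-2) ^+ 3 + t (-3) ^+ 3 + t (-4) ^+ 3
      - 3 * t (-4) * t (-3) * t (-1) - 3 * t 4 * t 3 * t 1
      - 3 * t (-4) * t 2 * t 3 - 3 * t 4 * t (-2) * t (-3)
      + 3 * t (-4) * t (-2) * t 1 + 3 * t 4 * t 2 * t (-1)
      + 3 * t 1 * t 2 * t (-3) + 3 * t (-1) * t (-2) * t 3
      + t (-2) * t (-1) * t 2 * t 1 + t (-3) * t (-2) * t 3 * t 2
      + t (-4) * t (-1) * t 4 * t 1 + t (-4) * t (-2) * t 4 * t 2
      + t (-3) * t (-1) * t 3 * t 1 + t (-3) * t (-4) * t 3 * t 4
      + t (-4) ^+ 2 * t (-3) * t (-2) + t 4 ^+ 2 * t 3 * t 2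
      + t (-1) ^+ 2 * t (-2) * t (-4) + t 1 ^+ 2 * t 2 * t 4
      + t 1 * t (-2) ^+ 2 * t (-3) + t (-1) * t 2 ^+ 2 * t 3
      + t (-4) * t (-3) * t 1 ^+ 2 + t 4 * t 3 * t (-1) ^+ 2
      + t (-4) * t 2 * t (-3) ^+ 2 + t 4 * t (-2) * t 3 ^+ 2
      + t (-1) ^+ 2 * t (-3) * t 2 + t 1 ^+ 2 * t 3 * t (-2)
      + t (-4) * t 1 * t 2 ^+ 2 + t 4 * t (-1) * t (-2) ^+ 2
      + t (-4) * t 3 * t (-2) ^+ 2 + t 4 * t (-3) * t 2 ^+ 2
      + t 1 * t 3 * t (-4) ^+ 2 + t (-1) * t (-3) * t 4 ^+ 2
      + t (-1) * t (-4) * t 3 ^+ 2 + t 1 * t 4 * t (-3) ^+ 2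
      - 2 * t (-3) ^+ 2 * t (-2) * t (-1) - 2 * t 3 ^+ 2 * t 2 * t 1
      - 2 * t (-4) ^+ 2 * t (-1) * t 2 - 2 * t 4 ^+ 2 * t 1 * t (-2)
      + t (-1) ^+ 2 * t (-2) ^+ 2 * t (-3) + t 1 ^+ 2 * t 2 ^+ 2 * t 3
      + t (-4) * t (-1) ^+ 2 * t 2 ^+ 2 + t 4 * t 1 ^+ 2 * t (-2) ^+ 2
      - t (-4) * t (-2) ^+ 2 * t 2 * t 1 - t 4 * t 2 ^+ 2 * t (-2) * t (-1)
      - t (-3) * t 1 ^+ 2 * t (-1) * t 2 - t 3 * t (-1) ^+ 2 * t 1 * t (-2)
      - t (-3) * t 2 ^+ 2 * t (-2) * t 1 - t 3 * t (-2) ^+ 2 * t 2 * t (-1)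
      - t (-4) * t (-2) * t (-1) * t 1 ^+ 2 - t 4 * t 2 * t 1 * t (-1) ^+ 2
      - t (-1) * t (-2) ^+ 3 * t 1 - t (-1) * t 2 ^+ 3 * t 1
      - t (-1) ^+ 3 * t (-2) * t 2 - t 1 ^+ 3 * t (-2) * t 2
      - t (-4) * t (-3) * t (-2) * t (-1) * t 2
      - t 4 * t 3 * t 2 * t 1 * t (-2) - t (-1) * t 1 * t 2 * t (-4) * t 3
      - t (-1) * t 1 * t (-2) * t 4 * t (-3)
      + t (-2) * t (-1) ^+ 2 * t 1 ^+ 2 * t 2
      + t (-1) * t (-2) ^+ 2 * t 2 ^+ 2 * t 1.
Proof.
(* Setting both determinants to 1 undoes the homogenisation and gives Q. *)
exists (commutator_poly _ 1 1 (t 1) (t (-1)) (t 2) (t (-2)) (t 3) (t (-3))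
         (t 4) (t (-4))).
- apply: Pi_sub_commutator.
  rewrite rmorph_commutator_poly rmorph1 !trace_map_t //.
  (* The generic matrices have determinant 1, so here the adjugates are the inverses that occur in
     [word]. *)
  have := tr_commutator_mul_adj _ (gen1 K) (gen2 K).
  rewrite /= det_gen1 det_gen2 -!inv_mx_adj ?det_gen1 ?det_gen2 // => ->.
- rewrite /commutator_poly.
  move: (t 1) (t (-1)) (t 2) (t (-2)) (t 3) (t (-3)) (t 4) (t (-4)).
  move=> t1 s1 t2 s2 t3 s3 t4 s4.
  ring.
Qed.
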